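(* Let $(\mathrm{U}_m(q),\mathrm{U}_{m'}(q))$ be a unitary dual pair with $m\ge 2m'$, let $k$ and $\theta(k)$ be as in the context, and suppose that $k$ is even and different from zero. Suppose $l=\frac12\left(m-\frac{k(k+1)}{2}\right)$ and $l'=\frac12\left(m'-\frac{\theta(k)(\theta(k)+1)}{2}\right)$ are non-negative integers, and let $\Omega_{l,l'}$ be the representation of $W_l\times W_{l'}$ given by $$\Omega_{l,l'}=\sum_{r=0}^{\min(l,l')}\ \sum_{(\xi,\zeta)\in\mathscr{P}_2(r)}\ \sum_{\eta,\eta'}\chi_{\xi,\eta}\otimes\chi_{\eta',\xi},$$ where the third sum is over partitions $\eta$ of $l-|\xi|$ and $\eta'$ of $l'-|\xi|$ such that $\zeta\preceq\eta$ and $\zeta\preceq\eta'$. Let $(\xi',\eta')$ be a bipartition of $l'$, with $\xi'=(\xi'_1,\ldots,\xi'_r)$, and let $\Theta(\xi',\eta')$ be the set of bipartitions $(\alpha,\beta)$ of $l$ such that $\chi_{\alpha,\beta}\otimes\chi_{\xi',\eta'}$ appears in $\Omega_{l,l'}$, ordered by: $(\alpha,\beta)$ precedes $(\alpha'',\beta'')$ if and only if $\mu_k(\alpha,\beta)\le\mu_k(\alpha'',\beta'')$. Then: 1. The unique minimal representation in $\Theta(\xi',\eta')$ is given by the bipartition $(\eta',(l-l')\cup\xi')$. 2. The unique maximal representation in $\Theta(\xi',\eta')$ is given by the bipartition $(\eta',(l-l'+\xi'_1+\xi'_2,\xi'_3,\ldots,\xi'_r))$.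
   Context: Partitions $\mu=(\mu_1\ge\mu_2\ge\cdots)$ are identified up to trailing zeros; $|\mu|$ is the sum of the parts; $a\cup\mu$ is the partition obtained by adjoining the part $a$ to $\mu$. For partitions of possibly different integers, $\mu\preceq\mu'$ means $\mu'_{i+1}\le\mu_i\le\mu'_i$ for all $i$. For partitions of the same integer, $\mu\le\mu'$ means $\mu_1+\cdots+\mu_j\le\mu'_1+\cdots+\mu'_j$ for all $j$. $\mathscr{P}_2(n)$ is the set of bipartitions of $n$ (pairs of partitions $(\lambda,\mu)$ with $|\lambda|+|\mu|=n$). $W_n$ is the Weyl group of type $B_n$ and $\chi_{\lambda,\mu}$ is its irreducible representation indexed by $(\lambda,\mu)\in\mathscr{P}_2(n)$. The group $\mathrm{U}_n(q)$ has a (unique) cuspidal unipotent representation $\lambda_k$ exactly when $n=k(k+1)/2$. For the Witt towers containing $\mathrm{U}_m(q)$ and $\mathrm{U}_{m'}(q)$, the first occurrence in the Howe correspondence sends $\lambda_k$ to $\lambda_{\theta(k)}$, where $\theta(k)\in\{k-1,k+1\}$ is determined by $\theta(k)(\theta(k)+1)/2\equiv m' \pmod 2$. Here $k$ is such that $k(k+1)/2\equiv m\pmod 2$. The representation $\Omega_{l,l'}$ describes the Howe correspondence between the unipotent Harish-Chandra series of $\lambda_k$ and $\lambda_{\theta(k)}$. The condition $m\ge2m'$ is the stable range condition. For a partition $\mu$ and an integer $t$ at least its number of parts, the $t$-set of $\beta$-numbers is $\beta^t_\mu=\{\mu_i+t-i: 1\le i\le t\}$; conversely a finite set of non-negative integers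 $\beta_1>\cdots>\beta_t$ defines the partition with parts $\beta_i-t+i$. Put $\beta^t_\mu(0)=\{b/2: b\in\beta^t_\mu \text{ even}\}$ and $\beta^t_\mu(1)=\{(b-1)/2: b\in\beta^t_\mu\text{ odd}\}$, and let $\mu(0),\mu(1)$ be the partitions they define. The pair $(\mu(0),\mu(1))$ depends only on $t$ modulo $2$; for $t$ odd it is called the $2$-quotient of parameter $1$ of $\mu$. The $2$-core of $\mu$ is the partition obtained by removing as many rim $2$-hooks (dominoes whose removal leaves a Young diagram) as possible; the $2$-cores are the partitions $\tau_k=(k,k-1,\ldots,1)$. For a bipartition $(\alpha,\beta)$ of $l$, $\mu_k(\alpha,\beta)$ is the unique partition of $m=2l+k(k+1)/2$ with $2$-core $\tau_k$ and $2$-quotient of parameter $1$ equal to $(\alpha,\beta)$. (This partition parametrizes the unipotent character of $\mathrm{U}_m(q)$ corresponding to $\chi_{\alpha,\beta}$.) An element of $\Theta(\xi',\eta')$ is minimal (resp. maximal) if it is so for the order defined by $\mu_k$. *)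

(* Defs.v *)
From HB Require Import structures.
From mathcomp Require Import all_boot all_order all_fingroup all_algebra.
From mathcomp Require Import all_solvable all_field all_character.

Set Implicit Arguments.
Unset Strict Implicit.
Unset Printing Implicit Defensive.

Import GRing.Theory.
Local Open Scope nat_scope.

(* Partitions are in normal form, without zero parts; the usual mu_i (i >= 1)
   is [nth 0 mu i.-1], also beyond the last part, and |mu| is [sumn mu]. *)

Definition is_part (s : seq nat) : bool := sorted geq s && (0 \notin s).

Record part := Part { part_seq :> seq nat; _ : is_part part_seq }.

HB.instance Definition _ := [isSub for part_seq].
HB.instance Definition _ := [Countable of part by <:].

Lemma mkpart_subproof (s : seq nat) :
  is_part (sort geq [seq x <- s | 0 < x]).
Proof.
apply/andP; split; first by apply: sort_sorted => x y; exact: leq_total.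
by rewrite mem_sort mem_filter ltnn.
Qed.

(* The partition whose multiset of nonzero parts is that of [s]. *)
Definition mkpart (s : seq nat) : part := Part (mkpart_subproof s).

Definition adjoin (a : nat) (mu : part) : part := mkpart (a :: mu).

(* A partition of [n] has at most [n] parts, each at most [n]. *)
Definition parts_of (n : nat) : seq part :=
  [seq mu <- pmap insub [seq map val (s : seq 'I_n.+1) | s : {bseq n of 'I_n.+1}]
     | sumn (mu : part) == n].

Lemma parts_of_uniq n : uniq (parts_of n).
Proof.
apply: filter_uniq; apply: pmap_sub_uniq.
rewrite map_inj_uniq ?enum_uniq // => s t /(inj_map val_inj) eq_st.
exact: val_inj.
Qed.

Lemma mem_parts_of n (mu : part) : (mu \in parts_of n) = (sumn mu == n).
Proof.
rewrite mem_filter; case: eqP => //= sz_mu; rewrite mem_pmap_sub /=.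
have /andP[_ mu0] := valP mu.
have le_size (s : seq nat) : 0 \notin s -> size s <= sumn s.
  elim: s => //= x s IHs; rewrite in_cons negb_or => /andP[x0 /IHs le_s].
  by rewrite -add1n leq_add // lt0n eq_sym.
have le_mem (s : seq nat) x : x \in s -> x <= sumn s.
  elim: s => //= y s IHs; rewrite in_cons => /predU1P[->|/IHs le_x].
    exact: leq_addr.
  exact: leq_trans le_x (leq_addl _ _).
have sz_s : size [seq (inord x : 'I_n.+1) | x <- mu] <= n.
  by rewrite size_map -[leqRHS]sz_mu le_size.
apply/mapP; exists (Bseq sz_s); first by rewrite mem_enum.
rewrite /= -map_comp -[LHS]map_id; apply/eq_in_map => x /le_mem le_x /=.
by rewrite inordK // ltnS -sz_mu.
Qed.

Definition bipartitions (n : nat) : seq (part * part) :=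
  flatten [seq [seq (la, mu) | la <- parts_of a, mu <- parts_of (n - a)]
             | a <- iota 0 n.+1].

Lemma mem_bipartitions n (lm : part * part) :
  (lm \in bipartitions n) = (sumn lm.1 + sumn lm.2 == n).
Proof.
case: lm => la mu /=; apply/flatten_mapP/eqP => [[a]|<-].
  rewrite mem_iota ltnS /= => le_an /allpairsP[[x y] /= [+ + [-> ->]]].
  by rewrite !mem_parts_of => /eqP-> /eqP->; rewrite subnKC.
exists (sumn la); first by rewrite mem_iota ltnS leq_addr.
by apply: allpairs_f; rewrite mem_parts_of ?addKn.
Qed.

Lemma bipartitions_uniq n : uniq (bipartitions n).
Proof.
rewrite /bipartitions.
set F := fun a => [seq (la, mu) | la <- parts_of a, mu <- parts_of (n - a)].
have FE a x : x \in F a -> sumn x.1 = a.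
  by case/allpairsP=> -[y z] [/= + _ ->]; rewrite mem_parts_of => /eqP.
have : uniq (iota 0 n.+1) by exact: iota_uniq.
elim: (iota 0 n.+1) => //= a s IHs /andP[a_s /IHs us].
rewrite cat_uniq us andbT; apply/andP; split.
  by apply: allpairs_uniq => [||[? ?] [? ?] _ _ //]; exact: parts_of_uniq.
apply/hasPn => x /flatten_mapP[b b_s /FE xb]; apply: contra a_s => /FE xa.
by rewrite -xa xb.
Qed.

(* Indices beyond the two lengths impose no condition, see [interlaceP]. *)
Definition interlace (mu mu' : part) : bool :=
  all (fun i => nth 0 mu' i.+1 <= nth 0 mu i <= nth 0 mu' i)
      (iota 0 (maxn (size mu) (size mu'))).

Lemma interlaceP (mu mu' : part) :
  reflect (forall i, nth 0 mu' i.+1 <= nth 0 mu i <= nth 0 mu' i)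
          (interlace mu mu').
Proof.
apply: (iffP allP) => [int_mu i | int_mu i _]; last exact: int_mu.
have [lt_i|] := ltnP i (maxn (size mu) (size mu')).
  by apply: int_mu; rewrite mem_iota.
rewrite geq_max => /andP[le_mu le_mu'].
by rewrite !(nth_default _ le_mu) !(nth_default _ le_mu') (nth_default _ (leqW le_mu')).
Qed.

Definition dominated (mu mu' : part) : Prop :=
  sumn mu = sumn mu' /\ forall j, sumn (take j mu) <= sumn (take j mu').


(* Finite sets of beta-numbers are represented by strictly decreasing lists;
   the subtractions below are never truncated when size mu <= t, respectively
   when [b] is strictly decreasing. *)
Definition beta_set (t : nat) (mu : part) : seq nat :=
  [seq nth 0 mu i + t - i.+1 | i <- iota 0 t].

Definition part_of_beta (b : seq nat) : part :=
  mkpart [seq nth 0 b i - (size b - i.+1) | i <- iota 0 (size b)].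

Definition two_quotient (t : nat) (mu : part) : part * part :=
  (part_of_beta [seq b./2 | b <- beta_set t mu & ~~ odd b],
   part_of_beta [seq b./2 | b <- beta_set t mu & odd b]).

(* The 2-quotient of parameter 1, computed with the least odd t >= size mu. *)
Definition two_quotient1 (mu : part) : part * part :=
  two_quotient (if odd (size mu) then size mu else (size mu).+1) mu.

(* Cells (row, column) of Young diagrams are numbered from 0. *)
Definition in_diagram (mu : part) (c : nat * nat) : bool := c.2 < nth 0 mu c.1.

Definition is_domino (c d : nat * nat) : bool :=
  (d == (c.1, c.2.+1)) || (d == (c.1.+1, c.2)).

Definition domino_removal (mu nu : part) : Prop :=
  exists c d : nat * nat,
    [/\ is_domino c d, ~~ in_diagram nu c, ~~ in_diagram nu d
      & forall x, in_diagram mu x = [|| in_diagram nu x, x == c | x == d]].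

Fixpoint domino_removals (n : nat) (mu nu : part) : Prop :=
  if n is p.+1 then
    exists2 rho, domino_removal mu rho & domino_removals p rho nu
  else mu = nu.

Definition is_two_core (mu nu : part) : Prop :=
  exists2 n, domino_removals n mu nu
           & forall p rho, domino_removals p mu rho -> p <= n.

Definition triangle (k : nat) : nat := (k * k.+1)./2.

Definition staircase (k : nat) : part := mkpart (rev (iota 1 k)).

(* [is_mu_k k l ab mu]: mu is the partition mu_k(alpha, beta) attached to the
   bipartition ab = (alpha, beta) of l. *)
Definition is_mu_k (k l : nat) (ab : part * part) (mu : part) : Prop :=
  [/\ sumn mu = l.*2 + triangle k, is_two_core mu (staircase k)
    & two_quotient1 mu = ab].

Definition precedes (k l : nat) (ab ab' : part * part) : Prop :=
  exists mu mu', [/\ is_mu_k k l ab mu, is_mu_k k l ab' mu' & dominated mu mu'].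

(* The Weyl group of type B_n is the group of signed permutations: those
   permutations of the 2n signed letters that commute with the sign change. *)

Definition flip_sign (n : nat) (x : 'I_n * bool) : 'I_n * bool :=
  (x.1, ~~ x.2).

Lemma flip_sign_inj n : injective (@flip_sign n).
Proof. by apply: can_inj (@flip_sign n) _ => -[i b]; rewrite /flip_sign negbK. Qed.

Definition W (n : nat) : {group {perm 'I_n * bool}} :=
  'C[perm (@flip_sign_inj n)]%G.

(* A family [chi] indexes the irreducible characters of all the groups W_n by
   bipartitions of n; the values of [chi n] outside P_2(n) are irrelevant. *)
Definition irr_indexing (chi : forall n, part * part -> 'CF(W n)) : Prop :=
  forall n,
    {in bipartitions n &, injective (chi n)} /\
    (forall phi : 'CF(W n),
       phi \in irr (W n) <-> exists2 lm, lm \in bipartitions n & phi = chi n lm).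

Section Tensor.

Variables (gT hT : finGroupType) (G : {group gT}) (H : {group hT}).

Lemma isom_setXl :
  isom G (setX G 1%g) (restrm (subsetT G) (@pairg1 gT hT)).
Proof.
apply/eqP/setP => -[x y]; rewrite !inE /= xpair_eqE.
apply/imsetP/andP => [[z /setD1P[nt_z Gz] [-> ->]]|[nt_xy /andP[Gx /eqP y1]]].
  by rewrite (negPf nt_z) eqxx andbT Gz.
exists x; last by rewrite y1.
by rewrite !inE Gx andbT; rewrite y1 eqxx andbT in nt_xy.
Qed.

Lemma isom_setXr :
  isom H (setX 1%g H) (restrm (subsetT H) (@pair1g gT hT)).
Proof.
apply/eqP/setP => -[x y]; rewrite !inE /= xpair_eqE.
apply/imsetP/andP => [[z /setD1P[nt_z Hz] [-> ->]]|[nt_xy /andP[/eqP x1 Hy]]].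
  by rewrite (negPf nt_z) andbF eqxx Hz.
exists y; last by rewrite x1.
by rewrite !inE Hy andbT; rewrite x1 eqxx in nt_xy.
Qed.

(* The external tensor product, a class function on the group G x H. *)
Definition cftensor (phi : 'CF(G)) (psi : 'CF(H)) : 'CF(setX_group G H) :=
  cfDprod (setX_dprod G H) (cfIsom isom_setXl phi) (cfIsom isom_setXr psi).

Lemma cftensorE (phi : 'CF(G)) (psi : 'CF(H)) g h :
  g \in G -> h \in H -> cftensor phi psi (g, h) = (phi g * psi h)%R.
Proof.
move=> Gg Hh; have -> : (g, h) = (pairg1 hT g * pair1g gT h)%g.
  by apply/eqP; rewrite xpair_eqE /= mulg1 mul1g !eqxx.
have G1h : pairg1 hT g \in setX G 1%g by rewrite !inE /= Gg eqxx.
have H1g : pair1g gT h \in setX 1%g H by rewrite !inE /= Hh eqxx.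
rewrite /cftensor cfDprodE //.
by rewrite (cfIsomE isom_setXl phi Gg) (cfIsomE isom_setXr psi Hh).
Qed.

End Tensor.

Section Howe.

Variable chi : forall n, part * part -> 'CF(W n).

(* The character of the representation Omega_(l, l') of W_l x W_l'. *)
Definition Omega (l l' : nat) : 'CF(setX_group (W l) (W l')) :=
  (\sum_(r < (minn l l').+1)
   \sum_(xz <- bipartitions r)
   \sum_(eta <- parts_of (l - sumn xz.1) | interlace xz.2 eta)
   \sum_(eta' <- parts_of (l' - sumn xz.1) | interlace xz.2 eta')
     cftensor (chi l (xz.1, eta)) (chi l' (eta', xz.1)))%R.

Definition Theta (l l' : nat) (xe' ab : part * part) : Prop :=
  ab \in bipartitions l /\
  '[Omega l l', cftensor (chi l ab) (chi l' xe')]%R != 0%R.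

End Howe.

Definition is_minimal (T : Type) (le : T -> T -> Prop) (A : T -> Prop) (x : T) :=
  A x /\ forall y, A y -> le y x -> y = x.

Definition is_maximal (T : Type) (le : T -> T -> Prop) (A : T -> Prop) (x : T) :=
  A x /\ forall y, A y -> le x y -> y = x.

Definition stable_range (m m' : nat) : Prop := m'.*2 <= m.

(* [is_theta m' k t]: t = theta(k), the index of the first occurrence of the
   cuspidal unipotent representation lambda_k of a unitary group in the Witt
   tower of U_m'; exactly one of k - 1 and k + 1 satisfies the congruence. *)
Definition is_theta (m' k t : nat) : Prop :=
  (t.+1 = k \/ t = k.+1) /\ triangle t = m' %[mod 2].

(* Main.v *)
Require Import Defs.
From mathcomp Require Import all_boot all_order all_fingroup all_algebra.
From mathcomp Require Import all_solvable all_field all_character.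
From mathcomp Require Import zify.

(** The scalar products of the summands of Omega with tensor products of
    irreducible characters are 0 or 1, so the set Theta(xi', eta') consists of
    the bipartitions (eta', beta) of l for which some zeta interlaces both beta
    and xi' ([ThetaP]). Such a zeta exists if and only if each row of beta is at
    least the next row of xi' and conversely ([common_interlaceP]); for i >= 2
    this says xi'_(i+1) <= beta_i <= xi'_(i-1), and for i = 1 that
    xi'_2 <= beta_1. Since |beta| is given, letting all rows but the first be as
    large as possible produces (l - l', xi'_1, xi'_2, ...), and as small as
    possible (l - l' + xi'_1 + xi'_2, xi'_3, ...). The stable range gives
    l - l' >= l' >= xi'_1 ([stable_range_leq]), so that the former is a partition
    and meets the condition on its first row. As tail sums decrease when partial
    sums increase, these two are the least and the greatest possible beta in the
    dominance order ([dominated_tails]).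

    It remains to carry dominance of beta over to dominance of mu_k(eta', beta),
    for a fixed first component ([mu_k_monotone]). In terms of t beta-numbers,
    with t odd and large, partial sums of a partition are sums of its largest
    beta-numbers up to a shift depending on t only. The even beta-numbers of
    mu_k(alpha, beta) come from alpha and the odd ones from beta, and how many
    of each there are depends on k and t only: removing a domino never changes
    the parities ([domino_removal_odd_beta]), and a staircase is determined by
    its number of odd beta-numbers ([odd_beta_staircase_inj]). A sum of largest
    beta-numbers is a sum of some largest even ones and some largest odd ones,
    and it is the maximum of the sums of this kind ([sumn_take_filter]); hence
    it can only increase with beta.

    The order is defined through partitions with prescribed 2-core and
    2-quotient, so their existence is needed as well ([mu_k_exists]). It rests
    on the criterion [is_two_coreP], which reads the 2-core off the parities of
    the beta-numbers; dominoes can be removed until a staircase is left because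
    only staircases have none ([staircase_or_domino]). *)

Local Open Scope nat_scope.

(** * Rows of partitions *)

Lemma nth_part_anti (mu : part) i j :
  i <= j -> nth 0 mu j <= nth 0 mu i.
Proof.
move=> le_ij; have [le_mu|lt_j] := leqP (size mu) j.
  by rewrite nth_default.
have /andP[mu_sorted _] := valP mu.
have geq_tr : transitive geq by move=> x y z h1 h2; apply: leq_trans h2 h1.
apply: (sorted_leq_nth geq_tr leqnn 0 mu_sorted); rewrite ?inE //.
exact: leq_ltn_trans lt_j.
Qed.

Lemma nth_part_gt0 (mu : part) i : (0 < nth 0 mu i) = (i < size mu).
Proof.
have [le_mu|lt_i] := leqP (size mu) i; first by rewrite nth_default.
rewrite lt0n; apply: contraTneq (mem_nth 0 lt_i) => ->.
by have /andP[_] := valP mu.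
Qed.

Lemma part_ext (mu nu : part) :
  (forall i, nth 0 mu i = nth 0 nu i) -> mu = nu.
Proof.
move=> eq_nth; apply: val_inj; apply: (@eq_from_nth nat 0) => [|i _];
  last exact: eq_nth.
apply/eqP; rewrite eqn_leq leqNgt -nth_part_gt0 eq_nth nth_default //=.
by rewrite leqNgt -nth_part_gt0 -eq_nth nth_default.
Qed.

Lemma sumn_take_nth (s : seq nat) j : sumn (take j s) = \sum_(i < j) nth 0 s i.
Proof.
elim: s j => [|x s IHs] [|j] /=; rewrite ?big_ord0 //.
  by rewrite big1 // => i _; rewrite nth_nil.
by rewrite big_ord_recl IHs.
Qed.

Lemma sumn_nth (s : seq nat) j : size s <= j -> sumn s = \sum_(i < j) nth 0 s i.
Proof. by move=> le_j; rewrite -sumn_take_nth take_oversize. Qed.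

Lemma nth_mkpart (s : seq nat) i :
  (forall j, nth 0 s j.+1 <= nth 0 s j) -> nth 0 (mkpart s) i = nth 0 s i.
Proof.
move=> s_anti; rewrite /mkpart /=.
have geq_tr : transitive geq by move=> x y z h1 h2; apply: leq_trans h2 h1.
have s_sorted : sorted geq s by apply/(sortedP 0) => j _; exact: s_anti.
rewrite sorted_sort //; last exact: sorted_filter.
elim: s i s_sorted {s_anti} => //= x s IHs i s_path.
have [x0|//|x0] := ltngtP.
  by case: i => //= i; apply/IHs/path_sorted/s_path.
have s0 : all (pred1 0) s.
  have := order_path_min geq_tr s_path; rewrite -x0.
  by apply: sub_all => y; rewrite /= leqn0.
have {s0}-> : s = nseq (size s) 0 by apply/all_pred1P.
rewrite (_ : [seq x <- nseq _ _ | 0 < x] = [::]).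
  by rewrite nth_nil -x0 -[0 :: _]/(nseq (size s).+1 0) nth_nseq if_same.
by apply/eqP; rewrite -(negbK (_ == _)) -has_filter has_nseq andbF.
Qed.

Lemma sumn_mkpart (s : seq nat) : sumn (mkpart s) = sumn s.
Proof.
rewrite /mkpart /= (perm_sumn (permEl (perm_sort _ _))).
by elim: s => //= x s IHs; case: posnP => [->|_] /=; rewrite IHs.
Qed.

Lemma leq_sumn_nth (s s' : seq nat) :
  (forall i, nth 0 s i <= nth 0 s' i) -> sumn s <= sumn s'.
Proof.
move=> le_s; rewrite (sumn_nth s (maxn (size s) (size s'))) ?leq_maxl //.
by rewrite (sumn_nth s' (maxn (size s) (size s'))) ?leq_maxr // leq_sum.
Qed.

(** Moving to the larger side of the dominance order only requires shrinking
    every row but the first: each tail sum decreases, so each partial sum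
    increases. *)
Lemma dominated_tails (mu nu : part) :
  sumn mu = sumn nu -> (forall i, nth 0 nu i.+1 <= nth 0 mu i.+1) ->
  dominated mu nu.
Proof.
move=> eq_sum le_tl; split=> // -[|j]; first by rewrite !take0.
have tail (la : part) : sumn la = sumn (take j.+1 la) + sumn (drop j.+1 la).
  by rewrite -sumn_cat cat_take_drop.
have le_drop : sumn (drop j.+1 nu) <= sumn (drop j.+1 mu).
  by apply: leq_sumn_nth => i; rewrite !nth_drop addSn.
by move: (tail mu) (tail nu); lia.
Qed.

Lemma dominated_anti (mu nu : part) :
  dominated mu nu -> dominated nu mu -> mu = nu.
Proof.
move=> [_ le_mn] [_ le_nm]; apply: part_ext => i.
have eqs j : \sum_(i < j) nth 0 mu i = \sum_(i < j) nth 0 nu i.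
  by apply/eqP; rewrite -!sumn_take_nth eqn_leq le_mn le_nm.
by have := eqs i.+1; rewrite !big_ord_recr /= eqs => /addnI.
Qed.

(** * Beta-numbers *)

Lemma size_beta_set t mu : size (beta_set t mu) = t.
Proof. by rewrite size_map size_iota. Qed.

Lemma nth_beta_set t mu i :
  i < t -> nth 0 (beta_set t mu) i = nth 0 mu i + (t - i.+1).
Proof. by move=> lt_it; rewrite (nth_map 0) ?size_iota // nth_iota // addnBA. Qed.

Lemma beta_set_sorted t mu : sorted gtn (beta_set t mu).
Proof.
apply/(sortedP 0) => i; rewrite size_beta_set => lt_it.
rewrite !nth_beta_set //=; last exact: ltnW.
by have := nth_part_anti mu i i.+1 (leqnSn i); lia.
Qed.

Lemma sorted_gtn_slope (b : seq nat) i :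
  sorted gtn b -> i < size b -> size b - i.+1 <= nth 0 b i.
Proof.
elim: b i => //= x b IHb [|i] b_sorted lt_i; last first.
  by rewrite subSS IHb // (path_sorted b_sorted).
case: b b_sorted IHb {lt_i} => //= y b /andP[lt_yx b_sorted] IHb.
by have /= := IHb 0 b_sorted isT; lia.
Qed.

Lemma nth_part_of_beta (b : seq nat) i :
  sorted gtn b -> i < size b ->
  nth 0 b i = nth 0 (part_of_beta b) i + (size b - i.+1).
Proof.
move=> b_sorted lt_i.
have nthE j : nth 0 [seq nth 0 b i - (size b - i.+1) | i <- iota 0 (size b)] j
    = nth 0 b j - (size b - j.+1).
  have [le_j|lt_j] := leqP (size b) j.
    by rewrite !nth_default ?size_map ?size_iota.
  by rewrite (nth_map 0) ?size_iota // nth_iota.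
rewrite nth_mkpart => [|j]; first by rewrite nthE subnK // sorted_gtn_slope.
rewrite !nthE; have [le_j|lt_j] := leqP (size b) j.+1.
  by rewrite nth_default.
by have /(_ j lt_j) /= := sortedP 0 b_sorted; lia.
Qed.

Lemma size_part_of_beta (b : seq nat) : size (part_of_beta b) <= size b.
Proof.
rewrite /= size_sort size_filter (leq_trans (count_size _ _)) //.
by rewrite size_map size_iota.
Qed.

Lemma part_of_betaK (b : seq nat) :
  sorted gtn b -> beta_set (size b) (part_of_beta b) = b.
Proof.
move=> b_sorted; apply: (@eq_from_nth nat 0); rewrite size_beta_set // => i lt_i.
by rewrite nth_beta_set // -nth_part_of_beta.
Qed.

Lemma beta_setK t (mu : part) : size mu <= t -> part_of_beta (beta_set t mu) = mu.
Proof.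
move=> le_t; apply: part_ext => i; have [le_ti|lt_it] := leqP t i.
  rewrite !nth_default // ?(leq_trans le_t) //.
  by rewrite (leq_trans (size_part_of_beta _)) ?size_beta_set.
have := nth_part_of_beta _ _ (beta_set_sorted t mu).
by rewrite size_beta_set => /(_ i lt_it); rewrite nth_beta_set // => /addIn.
Qed.

(** Replacing a partition by its beta-numbers shifts each partial sum by an
    amount that depends only on the number of beta-numbers, so that dominance
    can be read off partial sums of beta-numbers. *)
Lemma sumn_take_beta (b : seq nat) i :
  sorted gtn b -> i <= size b ->
  sumn (take i b)
    = sumn (take i (part_of_beta b)) + \sum_(j < i) (size b - j.+1).
Proof.
move=> b_sorted le_i; rewrite !sumn_take_nth -big_split /=.
apply: eq_bigr => j _; apply: nth_part_of_beta => //.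
exact: leq_trans (ltn_ord j) le_i.
Qed.

Lemma sumn_take_beta_set t (mu : part) i :
  size mu <= t -> i <= t ->
  sumn (take i (beta_set t mu)) = sumn (take i mu) + \sum_(j < i) (t - j.+1).
Proof.
move=> le_mu le_i.
by rewrite sumn_take_beta ?beta_set_sorted ?size_beta_set ?beta_setK.
Qed.

(** This is used with [P] the parity of beta-numbers, where it bounds sums over
    even and over odd beta-numbers by a sum over the merged list. Equality holds
    when [i] and [j] count the two kinds among the first [i + j] entries. *)
Lemma sumn_take_filter (P : pred nat) (b : seq nat) i j :
  sorted geq b ->
  sumn (take i [seq x <- b | P x]) + sumn (take j [seq x <- b | ~~ P x])
    <= sumn (take (i + j) b).
Proof.
have shift x s n : path geq x s -> sumn (take n s) <= sumn (take n (x :: s)).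
  elim: n x s => [|n IHn] x [|y s] //= /andP[le_yx s_path].
  by rewrite leq_add ?IHn.
elim: b i j => //= x b IHb i j b_path.
have {}IHb := IHb _ _ (path_sorted b_path).
case: (P x) => /=; [case: i => [|i] | case: j => [|j]] => /=.
- rewrite !add0n; apply: leq_trans (shift x b j b_path).
  by have := IHb 0 j; rewrite take0.
- by rewrite -addnA leq_add2l.
- rewrite !addn0; apply: leq_trans (shift x b i b_path).
  by have := IHb i 0; rewrite take0 !addn0.
- by rewrite addnCA addnS /= leq_add2l.
Qed.

(** * The 2-quotient *)

(** The partition is unchanged because the new least number 0 adds an empty row
    and lifts each of the other numbers by 1. *)
Lemma part_of_beta_shift (b : seq nat) :
  part_of_beta (rcons (map S b) 0) = part_of_beta b.
Proof.
apply: val_inj; rewrite /= size_rcons size_map.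
rewrite -[in iota _ _]addn1 iotaD map_cat filter_cat /= add0n.
rewrite nth_rcons size_map ltnn eqxx /= cats0.
congr (sort _ (filter _ _)); apply/eq_in_map => i.
rewrite mem_iota add0n => /andP[_ lt_i].
by rewrite nth_rcons size_map lt_i (nth_map 0) //; lia.
Qed.

Lemma beta_set_add2 t (mu : part) : size mu <= t ->
  beta_set t.+2 mu = [seq x.+2 | x <- beta_set t mu] ++ [:: 1; 0].
Proof.
move=> le_t; rewrite {1}/beta_set -addn2 iotaD map_cat -map_comp.
congr (_ ++ _) => /=; last by rewrite !nth_default //; [congr [:: _; _]; lia | lia].
by apply/eq_in_map => i; rewrite mem_iota /=; lia.
Qed.

Lemma two_quotient_add2 t (mu : part) : size mu <= t ->
  two_quotient t.+2 mu = two_quotient t mu.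
Proof.
move=> le_t; rewrite /two_quotient beta_set_add2 // !filter_cat !map_cat /= !cats1.
have shiftE (P : pred nat) (s : seq nat) : (forall x, P x.+2 = P x) ->
    [seq b./2 | b <- [seq x.+2 | x <- s] & P b]
      = [seq x.+1 | x <- [seq b./2 | b <- s & P b]].
  move=> P2; rewrite filter_map -!map_comp; congr map; exact: eq_filter.
by rewrite !shiftE ?part_of_beta_shift //= => x; rewrite !negbK.
Qed.

Lemma two_quotient1E t (mu : part) : odd t -> size mu <= t ->
  two_quotient1 mu = two_quotient t mu.
Proof.
move=> t_odd le_t; rewrite /two_quotient1; set t0 := if _ then _ else _.
have [t0_odd le_t0] : odd t0 /\ size mu <= t0 <= t.
  by rewrite /t0; case: ifP; lia.
have [n ->] : exists n, t = t0 + n.*2 by exists ((t - t0)./2); lia.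
elim: n => [|n IHn]; first by rewrite addn0.
by rewrite doubleS !addnS two_quotient_add2 //; lia.
Qed.

(** * Dominoes and 2-cores *)

(** A horizontal domino shortens one row by 2; a vertical one shortens two
    consecutive rows by 1, after which they are equal. *)
Lemma domino_removalP (mu nu : part) :
  domino_removal mu nu <->
  exists i,
    (nth 0 mu i = (nth 0 nu i).+2 /\ forall r, r != i -> nth 0 mu r = nth 0 nu r)
    \/ [/\ nth 0 mu i = (nth 0 nu i).+1, nth 0 mu i.+1 = (nth 0 nu i.+1).+1,
           nth 0 nu i = nth 0 nu i.+1
         & forall r, r != i -> r != i.+1 -> nth 0 mu r = nth 0 nu r].
Proof.
split=> [[[i j] [d [c_d /= nu_c nu_d mu_nu]]]|[i rows]].
  have row r x := mu_nu (r, x); rewrite /in_diagram /= in row nu_c.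
  case/orP: c_d nu_d row => /eqP-> /= nu_d row; rewrite /in_diagram /= in nu_d;
    exists i; [left | right].
    have rowE r x : (x < nth 0 mu r)
        = (x < nth 0 nu r) || (r == i) && ((x == j) || (x == j.+1)).
      by rewrite row !xpair_eqE -andb_orr.
    split=> [|r /negPf r_i].
      have := rowE i j; have := rowE i j.+1; have := rowE i j.+2.
      by have := rowE i (nth 0 nu i); rewrite eqxx; lia.
    have := rowE r (nth 0 nu r); have := rowE r (nth 0 mu r).
    by rewrite r_i /=; lia.
  have rowE r x : (x < nth 0 mu r)
      = (x < nth 0 nu r) || ((r == i) || (r == i.+1)) && (x == j).
    by rewrite row !xpair_eqE -andb_orl.
  have [e1 e2] : nth 0 nu i = j /\ nth 0 mu i = j.+1.
    have := rowE i j; have := rowE i j.+1.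
    by have := rowE i (nth 0 nu i); rewrite eqxx; lia.
  have [e3 e4] : nth 0 nu i.+1 = j /\ nth 0 mu i.+1 = j.+1.
    have := rowE i.+1 j; have := rowE i.+1 j.+1.
    by have := rowE i.+1 (nth 0 nu i.+1); rewrite eqxx orbT; lia.
  split; rewrite ?e1 ?e2 ?e3 ?e4 // => r /negPf r_i /negPf r_i1.
  have := rowE r (nth 0 nu r); have := rowE r (nth 0 mu r).
  by rewrite r_i r_i1 /=; lia.
case: rows => [[mu_i mu_r]|[mu_i mu_i1 nu_i mu_r]].
  exists (i, nth 0 nu i), (i, (nth 0 nu i).+1).
  rewrite /is_domino /in_diagram eqxx /= !ltnn ltnNge leqnSn.
  split=> // -[r x]; rewrite /= !xpair_eqE -andb_orr.
  have [->|r_i] := eqVneq r i; first by rewrite mu_i; lia.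
  by rewrite mu_r // orbF.
exists (i, nth 0 nu i), (i.+1, nth 0 nu i).
rewrite /is_domino /in_diagram eqxx /= orbT.
split=> [//|||[r x]]; rewrite /= ?ltnn ?nu_i ?ltnn // -?nu_i /= !xpair_eqE.
have [->|r_i] := eqVneq r i; first by rewrite mu_i; lia.
have [->|r_i1] := eqVneq r i.+1; first by rewrite mu_i1 -nu_i; lia.
by rewrite mu_r // orbF.
Qed.

Lemma eq_sum_but1 t i (F F' : nat -> nat) : i < t ->
  (forall r, r != i -> F r = F' r) ->
  \sum_(r < t) F r + F' i = \sum_(r < t) F' r + F i.
Proof.
move=> lt_it eqF; rewrite (bigD1 (Ordinal lt_it)) //.
rewrite [in RHS](bigD1 (Ordinal lt_it)) //=.
rewrite (eq_bigr (fun r : 'I_t => F' r)).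
  by rewrite addnAC [RHS]addnAC (addnC (F i)).
by move=> r r_i; apply: eqF.
Qed.

Lemma eq_sum_but2 t i (F F' : nat -> nat) : i.+1 < t ->
  (forall r, r != i -> r != i.+1 -> F r = F' r) ->
  \sum_(r < t) F r + (F' i + F' i.+1) = \sum_(r < t) F' r + (F i + F i.+1).
Proof.
move=> lt_it eqF; pose G r := if r == i then F i else F' r.
have GF' : \sum_(r < t) G r + F' i = \sum_(r < t) F' r + G i.
  by apply: eq_sum_but1 => [|r /negPf r_i]; rewrite /G ?r_i // ltnW.
have FG : \sum_(r < t) F r + G i.+1 = \sum_(r < t) G r + F i.+1.
  apply: eq_sum_but1 => // r r_i1; rewrite /G.
  by have [->|r_i] := eqVneq r i; last exact: eqF.
have Gi : G i = F i by rewrite /G eqxx.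
have Gi1 : G i.+1 = F' i.+1 by rewrite /G gtn_eqF.
move: GF' FG; rewrite Gi Gi1.
by move: (\sum_(r < t) F r) (\sum_(r < t) F' r) (\sum_(r < t) G r) => a b c; lia.
Qed.

Definition odd_beta t (mu : part) := count odd (beta_set t mu).

Lemma odd_beta_sum t (mu : part) :
  odd_beta t mu = \sum_(i < t) odd (nth 0 mu i + (t - i.+1)).
Proof.
rewrite /odd_beta -sum1_count big_mkcond /= (big_nth 0) size_beta_set big_mkord.
by apply: eq_bigr => i _; rewrite nth_beta_set //; case: odd.
Qed.

Lemma domino_removal_sumn (mu nu : part) :
  domino_removal mu nu -> sumn mu = sumn nu + 2.
Proof.
case/domino_removalP => i rows.
pose t := i.+2 + size mu + size nu.
have [le_mu le_nu lt_i] : [/\ size mu <= t, size nu <= t & i.+1 < t].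
  by rewrite /t; split; lia.
rewrite (sumn_nth _ _ le_mu) (sumn_nth _ _ le_nu).
case: rows => [[mu_i mu_r]|[mu_i mu_i1 nu_i mu_r]].
  have := eq_sum_but1 t i (nth 0 mu) (nth 0 nu) (ltnW lt_i) mu_r.
  by rewrite mu_i -addn2 addnA addnAC => /addIn.
have := eq_sum_but2 t i (nth 0 mu) (nth 0 nu) lt_i mu_r.
by rewrite addn2 mu_i mu_i1 addSn !addnS -!addSn => /addIn.
Qed.

(** Sliding a domino off moves one beta-number down by 2, or two consecutive
    ones down by 1: the numbers of odd and of even beta-numbers persist. *)
Lemma domino_removal_odd_beta t (mu nu : part) :
  size mu <= t -> domino_removal mu nu ->
  size nu <= t /\ odd_beta t nu = odd_beta t mu.
Proof.
move=> le_mu /domino_removalP[i rows].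
have le_nth r : nth 0 nu r <= nth 0 mu r.
  case: rows => [[mu_i mu_r]|[mu_i mu_i1 _ mu_r]].
    by have [->|r_i] := eqVneq r i; [rewrite mu_i; lia | rewrite mu_r].
  have [->|r_i] := eqVneq r i; first by rewrite mu_i.
  by have [->|r_i1] := eqVneq r i.+1; [rewrite mu_i1 | rewrite mu_r].
split.
  by rewrite leqNgt -nth_part_gt0 -leqNgt (leq_trans (le_nth t)) ?nth_default.
rewrite !odd_beta_sum.
pose F (la : part) r := nat_of_bool (odd (nth 0 la r + (t - r.+1))).
case: rows => [[mu_i mu_r]|[mu_i mu_i1 nu_i mu_r]].
  have lt_it : i < t by apply: leq_trans le_mu; rewrite -nth_part_gt0 mu_i.
  have := eq_sum_but1 t i (F mu) (F nu) lt_it.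
  have -> : F mu i = F nu i by rewrite /F mu_i !addSn /= negbK.
  move=> eqF; apply/eqP; rewrite eq_sym -(eqn_add2r (F nu i)).
  by apply/eqP/eqF => r r_i; rewrite /F mu_r.
have lt_it : i.+1 < t by apply: leq_trans le_mu; rewrite -nth_part_gt0 mu_i1.
have := eq_sum_but2 t i (F mu) (F nu) lt_it.
have -> : F mu i + F mu i.+1 = F nu i + F nu i.+1.
  rewrite /F mu_i mu_i1 nu_i (_ : t - i.+1 = (t - i.+2).+1); last by lia.
  by rewrite !addnS !addSn /= !negbK addnC.
move=> eqF; apply/eqP; rewrite eq_sym -(eqn_add2r (F nu i + F nu i.+1)).
by apply/eqP/eqF => r r_i r_i1; rewrite /F mu_r.
Qed.

Lemma domino_removals_invariants n t (mu nu : part) :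
  size mu <= t -> domino_removals n mu nu ->
  [/\ sumn mu = sumn nu + n.*2, size nu <= t & odd_beta t nu = odd_beta t mu].
Proof.
elim: n mu => [|n IHn] mu le_mu /= => [<-|[rho mu_rho rho_nu]].
  by rewrite addn0.
have [le_rho <-] := domino_removal_odd_beta _ _ _ le_mu mu_rho.
have [sum_rho le_nu ->] := IHn _ le_rho rho_nu.
by rewrite (domino_removal_sumn _ _ mu_rho) sum_rho -addnA addn2 doubleS.
Qed.

Lemma part_of_rows (f : nat -> nat) n :
  (forall r, f r.+1 <= f r) -> (forall r, n <= r -> f r = 0) ->
  exists nu : part, forall r, nth 0 nu r = f r.
Proof.
move=> f_anti f0.
have nthE r : nth 0 (mkseq f n) r = f r.
  have [le_r|lt_r] := leqP n r; last exact: nth_mkseq.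
  by rewrite nth_default ?size_mkseq // f0.
exists (mkpart (mkseq f n)) => r.
by rewrite nth_mkpart ?nthE // => j; rewrite !nthE.
Qed.

Lemma nth_staircase k i : nth 0 (staircase k) i = k - i.
Proof.
have nthE j : nth 0 (rev (iota 1 k)) j = k - j.
  have [le_j|lt_j] := leqP k j.
    by rewrite nth_default ?size_rev ?size_iota //; lia.
  by rewrite nth_rev size_iota // nth_iota //; lia.
by rewrite nth_mkpart ?nthE // => j; rewrite !nthE; lia.
Qed.

(** A partition from which no domino can be removed descends by steps of
    exactly 1: a longer step frees a horizontal domino, and the last two rows
    of a block of equal rows end in a vertical one. *)
Lemma staircase_or_domino (mu : part) :
  (exists j, mu = staircase j) \/ (exists nu, domino_removal mu nu).
Proof.
pose h i := (nth 0 mu i.+1).+1 < nth 0 mu i.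
pose v i := (nth 0 mu i == nth 0 mu i.+1) && (nth 0 mu i.+2 < nth 0 mu i.+1).
have [/hasP[i _ /orP[gap|/andP[/eqP eq_i gap]]]|] :=
  boolP (has (fun i => h i || v i) (iota 0 (size mu))).
- right; have [||nu nuE] :=
    part_of_rows (fun r => nth 0 mu r - (r == i).*2) (size mu).
  + move=> r; have := nth_part_anti mu r r.+1 (leqnSn r).
    by rewrite /h in gap; have [->|_] := eqVneq r i; lia.
  + by move=> r le_r; rewrite nth_default.
  exists nu; apply/domino_removalP; exists i; left.
  rewrite nuE eqxx; split; first by rewrite /h in gap; lia.
  by move=> r /negPf r_i; rewrite nuE r_i subn0.
- right; have [||nu nuE] :=
    part_of_rows (fun r => nth 0 mu r - ((r == i) || (r == i.+1))) (size mu).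
  + move=> r; have := nth_part_anti mu r r.+1 (leqnSn r).
    have [->|r_i] := eqVneq r i; first by lia.
    by have [->|r_i1] := eqVneq r i.+1; lia.
  + by move=> r le_r; rewrite nth_default.
  exists nu; apply/domino_removalP; exists i; right.
  rewrite !nuE !eqxx orbT /=; split; try lia.
  by move=> r /negPf r_i /negPf r_i1; rewrite nuE r_i r_i1 subn0.
move/hasPn=> stuck; left.
have no_hv i : ~~ h i /\ ~~ v i.
  have [le_i|lt_i] := leqP (size mu) i.
    by rewrite /h /v !(nth_default _ (leqW _)) ?(nth_default _ le_i) // leqW.
  by apply/andP; rewrite -negb_or stuck // mem_iota.
exists (size mu); apply: part_ext => i; rewrite nth_staircase.
have [le_i|lt_i] := leqP (size mu) i.
  by rewrite nth_default //; lia.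
(* Count rows from the bottom, where the partition ends. *)
have rowE d : d < size mu ->
    nth 0 mu (size mu - d.+1) = d.+1 /\ nth 0 mu (size mu - d) = d.
  elim: d => [|d IHd] lt_d.
    have : 0 < nth 0 mu (size mu - 1) by rewrite nth_part_gt0; lia.
    have [+ _] := no_hv (size mu - 1); rewrite /h subn1 prednK //.
    by rewrite subn0 (nth_default _ (leqnn _)); lia.
  have [e1 e2] := IHd (ltnW lt_d); split=> //.
  have := no_hv (size mu - d.+2); rewrite /h /v.
  have := nth_part_anti mu _ _ (leqnSn (size mu - d.+2)).
  have -> : (size mu - d.+2).+1 = size mu - d.+1 by lia.
  have -> : (size mu - d.+1).+1 = size mu - d by lia.
  by rewrite e1 e2; lia.
have [] := rowE (size mu - i.+1); first by lia.
have -> : size mu - (size mu - i.+1).+1 = i by lia.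
by lia.
Qed.

Lemma domino_removals_to_staircase (mu : part) :
  exists n j, domino_removals n mu (staircase j).
Proof.
have [n] := ubnP (sumn mu); elim: n mu => // n IHn mu lt_mu.
have [[j ->]|[nu mu_nu]] := staircase_or_domino mu; first by exists 0, j.
have [|p [j nu_j]] := IHn nu; first by have := domino_removal_sumn _ _ mu_nu; lia.
by exists p.+1, j, nu.
Qed.

Lemma size_staircase k : size (staircase k) = k.
Proof.
have nth_gt0 i : (i < size (staircase k)) = (i < k).
  by rewrite -nth_part_gt0 nth_staircase subn_gt0.
have := nth_gt0 k; have := nth_gt0 (size (staircase k)).
by rewrite !ltnn; lia.
Qed.

(** Each of the [j] nonzero rows contributes a beta-number of the parity of
   [u.+1]; the zero rows contribute the numbers below [u]. *)
Lemma odd_beta_staircase j u :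
  odd_beta (j + u) (staircase j) = u./2 + j * ~~ odd u.
Proof.
elim: j => [|j IHj].
  rewrite addn0 add0n odd_beta_sum; elim: u => [|u IHu]; first by rewrite big_ord0.
  rewrite big_ord_recl nth_staircase sub0n add0n /= subn1 /=.
  rewrite (eq_bigr (fun i : 'I_u =>
    odd (nth 0 (staircase 0) i + (u - i.+1)) : nat)).
    by rewrite IHu; lia.
  by move=> i _; rewrite !nth_staircase.
rewrite odd_beta_sum addSn big_ord_recl nth_staircase.
rewrite (eq_bigr (fun i : 'I_(j + u) =>
  odd (nth 0 (staircase j) i + (j + u - i.+1)) : nat)).
  by rewrite -odd_beta_sum IHj /=; lia.
by move=> i _; rewrite !nth_staircase.
Qed.

Lemma odd_beta_staircase_odd t j : odd t -> j <= t ->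
  odd_beta t (staircase j) = (t - j)./2 + j * odd j.
Proof.
move=> t_odd le_j; have {1}-> : t = j + (t - j) by rewrite subnKC.
by rewrite odd_beta_staircase oddB // t_odd addTb negbK.
Qed.

(** For odd [t] the number of odd beta-numbers is less than [t / 2] on
    staircases of even height and more than [t / 2] on those of odd height,
    and strictly monotonic on each of the two kinds, hence it tells 2-cores
    apart. *)
Lemma odd_beta_staircase_inj t i j : odd t -> i <= t -> j <= t ->
  odd_beta t (staircase i) = odd_beta t (staircase j) -> i = j.
Proof.
move=> t_odd le_i le_j; rewrite !odd_beta_staircase_odd //.
by case: (boolP (odd i)); case: (boolP (odd j)); lia.
Qed.

(** Every chain of removals extends to one that ends in a staircase, and the
    number of odd beta-numbers leaves only one candidate for it; all complete
    chains then have the same length, which is the maximality that the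
    definition of a 2-core asks for. *)
Lemma is_two_coreP t k (mu : part) : odd t -> size mu <= t ->
  is_two_core mu (staircase k)
    <-> k <= t /\ odd_beta t mu = odd_beta t (staircase k).
Proof.
move=> t_odd le_mu; split=> [[n mu_k _]|[le_k eq_odd]].
  have [_ + ->] := domino_removals_invariants _ _ _ _ le_mu mu_k.
  by rewrite size_staircase.
have to_k (rho : part) : size rho <= t -> odd_beta t rho = odd_beta t mu ->
    exists n, domino_removals n rho (staircase k).
  move=> le_rho odd_rho; have [n [j rho_j]] := domino_removals_to_staircase rho.
  have [_ le_j odd_j] := domino_removals_invariants _ _ _ _ le_rho rho_j.
  rewrite size_staircase in le_j; exists n.
  by rewrite (odd_beta_staircase_inj t k j) // -eq_odd odd_j.
have [n mu_k] := to_k mu le_mu erefl; exists n => // p rho mu_rho.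
have [sum_mu le_rho odd_rho] := domino_removals_invariants _ _ _ _ le_mu mu_rho.
have [q rho_k] := to_k rho le_rho odd_rho.
have [sum_rho _ _] := domino_removals_invariants _ _ _ _ le_rho rho_k.
have [sum_mu' _ _] := domino_removals_invariants _ _ _ _ le_mu mu_k.
by move: sum_mu sum_rho sum_mu'; clear; lia.
Qed.

(** * The partition with given 2-core and 2-quotient *)

Lemma sum_staircase t : \sum_(j < t) (t - j.+1) = 'C(t, 2).
Proof.
elim: t => [|t IHt]; first by rewrite big_ord0.
by rewrite big_ord_recl subn1 binS bin1 addnC -IHt.
Qed.

Lemma sumn_beta_set t (mu : part) :
  size mu <= t -> sumn (beta_set t mu) = sumn mu + 'C(t, 2).
Proof.
move=> le_t; have := sumn_take_beta_set t mu t le_t (leqnn t).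
by rewrite !take_oversize ?size_beta_set // sum_staircase.
Qed.

Lemma double_half_sumn (s : seq nat) :
  sumn s = (sumn [seq x./2 | x <- s]).*2 + count odd s.
Proof. by elim: s => //= x s ->; lia. Qed.

Lemma filter_take_count (P : pred nat) j (s : seq nat) :
  [seq x <- take j s | P x] = take (count P (take j s)) [seq x <- s | P x].
Proof.
by rewrite -[in X in take _ (filter _ X)](cat_take_drop j s) filter_cat
  take_size_cat // size_filter.
Qed.

Lemma half_sorted (s : seq nat) (c : bool) :
  sorted gtn s -> all (fun x => odd x == c) s -> sorted gtn [seq x./2 | x <- s].
Proof.
move=> s_sorted s_c; rewrite sorted_map; apply/(sortedP 0) => i lt_i /=.
have /(_ i lt_i) /= := sortedP 0 s_sorted.
have /eqP := all_nthP 0 s_c i (ltnW lt_i); have /eqP := all_nthP 0 s_c i.+1 lt_i.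
by move=> <-; lia.
Qed.

Lemma sumn_take_parity (s : seq nat) (c : bool) i :
  sorted gtn s -> all (fun x => odd x == c) s -> i <= size s ->
  sumn (take i s)
    = (sumn (take i (part_of_beta [seq x./2 | x <- s]))
       + \sum_(r < i) (size s - r.+1)).*2 + i * c.
Proof.
move=> s_sorted s_c le_i; rewrite double_half_sumn map_take.
rewrite sumn_take_beta ?size_map ?half_sorted //; last exact: half_sorted s_c.
congr (_ + _); rewrite (eq_in_count (a2 := fun=> c)) => [|x /mem_take].
  by case: c {s_c}; rewrite ?count_predT ?size_takel ?muln1 // muln0 count_pred0.
by move/(allP s_c)/eqP.
Qed.

Lemma triangle_double k : (triangle k).*2 = k * k.+1.
Proof. by rewrite /triangle -[RHS]odd_double_half oddM /=; case: odd. Qed.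

(** The numbers 2a for a < s + k + 1 and 2b + 1 for b < s are the beta-numbers of
    tau_k when k is even, and both sides are their sum. *)
Lemma bin2_merge k s :
  ('C(s + k.+1, 2)).*2 + ('C(s, 2)).*2 + s = triangle k + 'C(s + k.+1 + s, 2).
Proof.
have bin2E n : ('C(n, 2)).*2 = n * n.-1.
  by rewrite bin2 -[RHS]odd_double_half oddM; case: n => //= n; rewrite andNb.
move: (bin2E (s + k.+1 + s)) (bin2E (s + k.+1)) (bin2E s) (triangle_double k).
move: (triangle k) 'C(_, 2) 'C(_, 2) 'C(_, 2) => x y z w.
by case: s => [|s] /=; nia.
Qed.

(** With [t] fixed, the 2-core fixes how many beta-numbers are odd, hence the
    2-quotient and the 2-core together determine the even and the odd
    beta-numbers. Enlarging the odd ones in the sense of partial sums enlarges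
    every partial sum of the merged list. *)
Lemma mu_k_monotone k l (al be be' mu mu' : part) :
  is_mu_k k l (al, be) mu -> is_mu_k k l (al, be') mu' ->
  dominated be be' -> dominated mu mu'.
Proof.
move=> [sum_mu core_mu quo_mu] [sum_mu' core_mu' quo_mu'] [_ le_be].
split=> [|j]; first by rewrite sum_mu.
have [t [t_odd le_mu le_mu']] :
    exists t, [/\ odd t, size mu <= t & size mu' <= t].
  by exists (size mu + size mu').*2.+1; split; lia.
wlog le_jt : j / j <= t => [IH|].
  have [/IH//|/ltnW le_tj] := leqP j t.
  by have := IH t (leqnn t); rewrite !take_oversize //; exact: leq_trans le_tj.
have [_ odd_mu] := (is_two_coreP t k mu t_odd le_mu).1 core_mu.
have [_ odd_mu'] := (is_two_coreP t k mu' t_odd le_mu').1 core_mu'.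
rewrite (two_quotient1E t) // in quo_mu.
rewrite (two_quotient1E t) // in quo_mu'.
case: quo_mu quo_mu' => quo_al quo_be [quo_al' quo_be'].
rewrite -(leq_add2r (\sum_(r < j) (t - r.+1))) -!sumn_take_beta_set //.
have {odd_mu odd_mu'} eq_odd : odd_beta t mu = odd_beta t mu' by rewrite odd_mu.
rewrite /odd_beta in eq_odd.
move: (beta_set_sorted t mu) (beta_set_sorted t mu').
move: (size_beta_set t mu) (size_beta_set t mu').
move: (beta_set t mu) (beta_set t mu') quo_al quo_be quo_al' quo_be' eq_odd.
move=> b b' quo_al quo_be quo_al' quo_be' eq_odd.
move=> size_b size_b' b_sorted b'_sorted.
have gtn_tr : transitive gtn by move=> x y z h1 h2; apply: ltn_trans h2 h1.
have odds (s : seq nat) : all (fun x => odd x == true) [seq x <- s | odd x].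
  by apply/allP => x; rewrite mem_filter => /andP[->].
have evens (s : seq nat) : all (fun x => odd x == false) [seq x <- s | ~~ odd x].
  by apply/allP => x; rewrite mem_filter eqbF_neg => /andP[->].
have eq_even : count (predC odd) b = count (predC odd) b'.
  by apply/(@addnI (count odd b)); rewrite {2}eq_odd !count_predC size_b.
pose i1 := count odd (take j b); pose i2 := count (predC odd) (take j b).
have j_def : i1 + i2 = j by rewrite count_predC size_takel ?size_b.
have le_i1 : i1 <= count odd b.
  by rewrite -[b in leqRHS](cat_take_drop j b) count_cat leq_addr.
have le_i2 : i2 <= count (predC odd) b.
  by rewrite -[b in leqRHS](cat_take_drop j b) count_cat leq_addr.
apply: (@leq_trans (sumn (take i1 [seq x <- b' | odd x])
                    + sumn (take i2 [seq x <- b' | ~~ odd x]))); last first.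
  rewrite -j_def; apply: sumn_take_filter.
  by apply: sub_sorted b'_sorted => x y; apply: ltnW.
rewrite -(perm_sumn (permEl (perm_filterC odd (take j b)))) sumn_cat.
rewrite filter_take_count (filter_take_count (predC odd)) -/i1 -/i2.
rewrite (sumn_take_parity [seq x <- b | odd x] true)
  1?(sumn_take_parity [seq x <- b' | odd x] true)
  1?(sumn_take_parity [seq x <- b | ~~ odd x] false)
  1?(sumn_take_parity [seq x <- b' | ~~ odd x] false) ?sorted_filter //
  ?size_filter -?eq_odd -?eq_even //.
rewrite quo_al quo_al' quo_be quo_be' leq_add2r leq_add2r leq_double leq_add2r.
exact: le_be.
Qed.

(** Merge even beta-numbers for [al] with odd ones for [be]. *)
Lemma mu_k_exists k l (al be : part) :
  ~~ odd k -> sumn al + sumn be = l -> exists mu, is_mu_k k l (al, be) mu.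
Proof.
move=> k_even sum_l; pose s := size al + size be.
have [le_al le_be] : size al <= s + k.+1 /\ size be <= s by rewrite /s; lia.
(* For even [k] and an odd number of rows, tau_k has [k.+1] more even than odd
   beta-numbers, and [s] is large enough for both components. *)
pose A := [seq x.*2 | x <- beta_set (s + k.+1) al].
pose B := [seq x.*2.+1 | x <- beta_set s be].
have A_sorted : sorted gtn A.
  rewrite sorted_map; apply: sub_sorted (beta_set_sorted _ _) => x y /=.
  by rewrite ltn_double.
have B_sorted : sorted gtn B.
  rewrite sorted_map; apply: sub_sorted (beta_set_sorted _ _) => x y /=.
  by rewrite ltnS ltn_double.
have odd_A : all (fun x => ~~ odd x) A.
  by apply/allP => _ /mapP[x _ ->]; rewrite odd_double.
have odd_B : all odd B by apply/allP => _ /mapP[x _ ->]; rewrite /= odd_double.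
have no_odd_A : [seq x <- A | odd x] = [::].
  by apply/eqP; rewrite -(negbK (_ == _)) -has_filter -all_predC.
have no_even_B : [seq x <- B | ~~ odd x] = [::].
  apply/eqP; rewrite -(negbK (_ == _)) -has_filter -all_predC.
  by apply: sub_all odd_B => x; rewrite /= negbK.
have geq_total : total geq by move=> x y; exact: leq_total.
have geq_tr : transitive geq by move=> x y z h1 h2; apply: leq_trans h2 h1.
have geq_anti : antisymmetric geq by move=> x y; rewrite /= andbC => /anti_leq.
have sorted_geq (r : seq nat) : sorted gtn r -> sort geq r = r.
  by rewrite gtn_sorted_uniq_geq => /andP[_]; exact: sorted_sort.
pose b := sort geq (A ++ B).
have odd_b : [seq x <- b | odd x] = B.
  by rewrite filter_sort // filter_cat (all_filterP odd_B) no_odd_A sorted_geq.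
have even_b : [seq x <- b | ~~ odd x] = A.
  rewrite filter_sort // filter_cat (all_filterP odd_A) no_even_B cats0.
  exact: sorted_geq.
have b_sorted : sorted gtn b.
  rewrite gtn_sorted_uniq_geq sort_sorted // andbT sort_uniq cat_uniq.
  have uniq_gtn (r : seq nat) : sorted gtn r -> uniq r.
    by rewrite gtn_sorted_uniq_geq => /andP[].
  rewrite !uniq_gtn // andbT; apply/hasPn => x /(allP odd_B) x_odd.
  by apply: contraL x_odd => /(allP odd_A).
pose t := s + k.+1 + s.
have size_b : size b = t by rewrite size_sort size_cat !size_map !size_iota.
have t_odd : odd t by rewrite /t; lia.
have bE : beta_set t (part_of_beta b) = b by rewrite -size_b part_of_betaK.
have le_b : size (part_of_beta b) <= t by rewrite -size_b size_part_of_beta.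
exists (part_of_beta b); split.
- apply/(@addIn 'C(t, 2)); rewrite -sumn_beta_set // bE.
  rewrite (perm_sumn (permEl (perm_sort _ _))) sumn_cat.
  have -> : sumn A = (sumn (beta_set (s + k.+1) al)).*2.
    by rewrite /A; elim: (beta_set _ _) => //= x r ->; rewrite doubleD.
  have -> : sumn B = (sumn (beta_set s be)).*2 + s.
    have sum_r (r : seq nat) :
        sumn [seq x.*2.+1 | x <- r] = (sumn r).*2 + size r.
      by elim: r => //= x r ->; lia.
    by rewrite sum_r size_beta_set.
  rewrite !sumn_beta_set // -sum_l; have := bin2_merge k s; rewrite -/t.
  move: 'C(_, 2) 'C(_, 2) 'C(_, 2) (triangle k) => x y z w.
  by lia.
- apply/(is_two_coreP t) => //; split; first by rewrite /t; lia.
  rewrite /odd_beta bE -size_filter odd_b size_map size_beta_set.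
  rewrite -/(odd_beta _ _) odd_beta_staircase_odd //; last by rewrite /t; lia.
  by rewrite (negPf k_even) muln0 addn0 /t; lia.
have half_A : [seq x./2 | x <- A] = beta_set (s + k.+1) al.
  by rewrite /A -map_comp -[RHS]map_id; apply: eq_map => x; exact: doubleK.
have half_B : [seq x./2 | x <- B] = beta_set s be.
  by rewrite /B -map_comp -[RHS]map_id; apply: eq_map => x; exact: uphalf_double.
rewrite (two_quotient1E t) // /two_quotient bE even_b odd_b half_A half_B.
by rewrite !beta_setK.
Qed.

(** * Constituents of Omega *)

Lemma cfdot_cftensor (gT hT : finGroupType) (G : {group gT}) (H : {group hT})
    (phi1 phi2 : 'CF(G)) (psi1 psi2 : 'CF(H)) :
  '[cftensor phi1 psi1, cftensor phi2 psi2]%R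
    = ('[phi1, phi2] * '[psi1, psi2])%R.
Proof. by rewrite /cftensor cfdot_dprod !cfIsom_iso. Qed.

Lemma cfdot_indexing (chi : forall n, part * part -> 'CF(W n)) n :
  irr_indexing chi ->
  {in bipartitions n &, forall a b, '[chi n a, chi n b]%R = (a == b)%:R%R}.
Proof.
move=> /(_ n)[chi_inj chi_irr] a b a_n b_n; rewrite -(inj_in_eq chi_inj a_n b_n).
have /irrP[i ->] : chi n a \in irr (W n) by apply/chi_irr; exists a.
have /irrP[j ->] : chi n b \in irr (W n) by apply/chi_irr; exists b.
by rewrite cfdot_irr (inj_eq irr_inj).
Qed.

Lemma interlace_leq_sumn (zeta mu : part) :
  interlace zeta mu -> sumn zeta <= sumn mu.
Proof. by move=> /interlaceP zm; apply: leq_sumn_nth => i; case/andP: (zm i). Qed.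

(** Every scalar product of a summand of Omega with a tensor product of
    irreducible characters is 0 or 1, so nothing cancels. *)
Lemma ThetaP (chi : forall n, part * part -> 'CF(W n)) l l'
    (xi' eta' al be : part) :
  irr_indexing chi -> (xi', eta') \in bipartitions l' ->
  Theta chi l l' (xi', eta') (al, be) <->
  [/\ al = eta', sumn al + sumn be = l
    & exists2 zeta, interlace zeta be & interlace zeta xi'].
Proof.
move=> chi_idx xe_l'; have sum_l' := xe_l'; rewrite mem_bipartitions /= in sum_l'.
rewrite /Theta mem_bipartitions /=.
pose hit (xi eta eta'' : part) :=
  ((xi, eta) == (al, be)) && ((eta'', xi) == (xi', eta')).
have dotE : sumn al + sumn be = l ->
  '[Omega chi l l', cftensor (chi l (al, be)) (chi l' (xi', eta'))]%R =
  (\sum_(r < (minn l l').+1) \sum_(xz <- bipartitions r)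
     \sum_(eta <- parts_of (l - sumn xz.1) | interlace xz.2 eta)
     \sum_(eta'' <- parts_of (l' - sumn xz.1) | interlace xz.2 eta'')
       hit xz.1 eta eta'')%:R%R.
  move=> sum_l; rewrite cfdot_suml GRing.natr_sum; apply: eq_bigr => r _.
  rewrite cfdot_suml GRing.natr_sum; apply: eq_big_seq => -[xi zeta] /=.
  rewrite mem_bipartitions /= => /eqP xz_r.
  rewrite cfdot_suml GRing.natr_sum big_seq_cond [RHS]big_seq_cond.
  apply: eq_bigr => eta /andP[+ _]; rewrite mem_parts_of => /eqP eta_sum.
  rewrite cfdot_suml GRing.natr_sum big_seq_cond [RHS]big_seq_cond.
  apply: eq_bigr => eta'' /andP[+ _]; rewrite mem_parts_of => /eqP eta''_sum.
  have lt_r := ltn_ord r.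
  rewrite cfdot_cftensor !(cfdot_indexing _ _ chi_idx) ?mem_bipartitions //=;
    try by move: lt_r; rewrite -xz_r; lia.
  by rewrite /hit; case: eqP; case: eqP; rewrite /= ?GRing.mulr1 ?GRing.mulr0.
split=> [[/eqP sum_l]|[al_eta sum_l [zeta z_be z_xi]]].
  rewrite dotE // Num.Theory.pnatr_eq0 sum_nat_seq_neq0 => /hasP[r _ /=].
  rewrite sum_nat_seq_neq0 => /hasP[[xi zeta] _ /=].
  rewrite sum_nat_seq_neq0 => /hasP[eta _ /andP[z_eta]].
  rewrite sum_nat_seq_neq0 => /hasP[eta'' _ /andP[z_eta'']].
  rewrite eqb0 negbK => /andP[/eqP[e1 e2] /eqP[e3 e4]].
  by split=> //; [rewrite -e1 | exists zeta; rewrite -?e2 -?e3].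
split; first exact/eqP.
have le_r : sumn al + sumn zeta < (minn l l').+1.
  have := interlace_leq_sumn _ _ z_be; have := interlace_leq_sumn _ _ z_xi.
  by move: sum_l'; rewrite -sum_l al_eta; lia.
rewrite dotE // Num.Theory.pnatr_eq0 sum_nat_seq_neq0; apply/hasP.
exists (Ordinal le_r); rewrite ?mem_index_enum //=.
rewrite sum_nat_seq_neq0; apply/hasP; exists (al, zeta).
  by rewrite mem_bipartitions.
rewrite sum_nat_seq_neq0; apply/hasP; exists be.
  by rewrite mem_parts_of /=; lia.
rewrite z_be sum_nat_seq_neq0; apply/hasP; exists xi'.
  by rewrite mem_parts_of /= al_eta; lia.
by rewrite z_xi /hit al_eta !eqxx.
Qed.

(** The interlacing partition can be chosen row by row, as long as each row of
    one partition is at least the next row of the other. *)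
Lemma common_interlaceP (mu nu : part) :
  (exists2 zeta, interlace zeta mu & interlace zeta nu) <->
  (forall i, nth 0 mu i.+1 <= nth 0 nu i /\ nth 0 nu i.+1 <= nth 0 mu i).
Proof.
split=> [[zeta /interlaceP z_mu /interlaceP z_nu] i|cross].
  by have /andP[] := z_mu i; have /andP[] := z_nu i; lia.
have [||zeta zetaE] :=
  part_of_rows (fun i => minn (nth 0 mu i) (nth 0 nu i)) (size mu).
- move=> i; have := nth_part_anti mu _ _ (leqnSn i).
  by have := nth_part_anti nu _ _ (leqnSn i); lia.
- by move=> i le_i; rewrite nth_default // min0n.
by exists zeta; apply/interlaceP => i; rewrite zetaE;
  have := cross i; have := nth_part_anti mu _ _ (leqnSn i);
  have := nth_part_anti nu _ _ (leqnSn i); lia.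
Qed.

(** * Extremal elements *)

(** Elements with the same first component are compared through the dominance
    order of their second components, which makes a dominance-extremal second
    component extremal for the order defined by [mu_k]. *)
Lemma precedes_of_dominated k l (al be be' : part) :
  ~~ odd k -> sumn al + sumn be = l -> dominated be be' ->
  precedes k l (al, be) (al, be').
Proof.
move=> k_even sum_l le_be; have [sum_be _] := le_be.
have [mu mu_k] := mu_k_exists k l al be k_even sum_l.
have [mu' mu'_k] : exists mu', is_mu_k k l (al, be') mu'.
  by apply: mu_k_exists; rewrite -?sum_be.
by exists mu, mu'; split=> //; apply: mu_k_monotone le_be; eassumption.
Qed.

Lemma precedes_dominated_eq k l (al be be' : part) :
  precedes k l (al, be) (al, be') -> dominated be' be -> be = be'.
Proof.
move=> [mu [mu' [mu_k mu'_k le_mu]]] le_be.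
have eq_mu : mu = mu'.
  by apply: dominated_anti le_mu _; apply: mu_k_monotone le_be; eassumption.
by case: mu_k mu'_k => _ _ + [_ _]; rewrite eq_mu => -> [].
Qed.

(** In particular l - l' >= l' >= xi'_1. For t = k - 1 the hypotheses only give
    4 l' <= 2 l + 1 when k = 2, and integrality concludes. *)
Lemma stable_range_leq m m' k t l l' :
  stable_range m m' -> ~~ odd k -> k != 0 -> is_theta m' k t ->
  m = l.*2 + triangle k -> m' = l'.*2 + triangle t -> l'.*2 <= l.
Proof.
rewrite /stable_range => + k_even k_neq0 [t_k _] m_def m'_def.
rewrite {}m_def {}m'_def doubleD.
have := triangle_double k; have := triangle_double t.
move: (triangle k) (triangle t) => x y.
case: t_k => [k_t|->]; last by nia.
by rewrite -k_t; nia.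
Qed.

Theorem theorem10
  (chi : forall n : nat, part * part -> 'CF(W n))
  (chi_indexing : irr_indexing chi)
  (m m' k t l l' : nat)
  (m_stable : stable_range m m')
  (k_even : ~~ odd k) (k_neq0 : k != 0)
  (t_theta : is_theta m' k t)
  (l_def : m = l.*2 + triangle k)
  (l'_def : m' = l'.*2 + triangle t)
  (xi' eta' : part)
  (xe'_bip : (xi', eta') \in bipartitions l') :
  (forall ab : part * part,
     is_minimal (precedes k l) (Theta chi l l' (xi', eta')) ab <->
     ab = (eta', adjoin (l - l') xi')) /\
  (forall ab : part * part,
     is_maximal (precedes k l) (Theta chi l l' (xi', eta')) ab <->
     ab = (eta', mkpart ((l - l' + nth 0 xi' 0 + nth 0 xi' 1) :: drop 2 xi'))).
Proof.
have le_ll' :=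
  stable_range_leq m m' k t l l' m_stable k_even k_neq0 t_theta l_def l'_def.
have /eqP /= sum_l' : sumn xi' + sumn eta' == l'.
  by rewrite -(mem_bipartitions _ (_, _)).
pose Th := Theta chi l l' (xi', eta').
have ThE al be : Th (al, be) <->
    [/\ al = eta', sumn eta' + sumn be = l
      & forall i, nth 0 be i.+1 <= nth 0 xi' i /\ nth 0 xi' i.+1 <= nth 0 be i].
  rewrite /Th ThetaP //; split=> [[-> sum_l /common_interlaceP cross]|].
    by split=> // i; have := cross i.
  by case=> -> sum_l cross; split=> //; apply/common_interlaceP => i; have := cross i.
have xi'_anti i := nth_part_anti xi' i i.+1 (leqnSn i).
have le_xi' : nth 0 xi' 0 <= l'.
  by rewrite -sum_l'; case: (part_seq xi') => //= x s; lia.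
set lo := adjoin _ _; set hi := mkpart _.
have loE i : nth 0 lo i = nth 0 (l - l' :: xi') i.
  by apply: nth_mkpart => -[|j] /=; [lia | exact: xi'_anti].
have hiE i :
    nth 0 hi i = nth 0 (l - l' + nth 0 xi' 0 + nth 0 xi' 1 :: drop 2 xi') i.
  apply: nth_mkpart => -[|j] /=; rewrite !nth_drop ?addnS ?add2n;
    last exact: xi'_anti.
  by have := xi'_anti 1; lia.
have sum_lo : sumn lo = l - l' + sumn xi' by rewrite sumn_mkpart.
have sum_hi : sumn hi = l - l' + sumn xi'.
  rewrite sumn_mkpart /= -[in RHS](cat_take_drop 2 xi') sumn_cat sumn_take_nth.
  by rewrite !big_ord_recr big_ord0 /=; lia.
have Th_lo : Th (eta', lo).
  apply/ThE; split=> //; first by lia.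
  move=> i; rewrite !loE /=; split=> //; case: i => [|i] /=.
    by have := xi'_anti 0; lia.
  by have := xi'_anti i; have := xi'_anti i.+1; lia.
have Th_hi : Th (eta', hi).
  apply/ThE; split=> //; first by lia.
  move=> i; rewrite !hiE; split.
    by have := xi'_anti i; have := xi'_anti i.+1; rewrite /= nth_drop add2n; lia.
  by case: i => [|i] /=; [lia | rewrite nth_drop add2n].
have lo_be be : Th (eta', be) -> dominated lo be.
  case/ThE => _ sum_l cross; apply: dominated_tails => [|i]; first by lia.
  by rewrite loE; case: (cross i).
have be_hi be : Th (eta', be) -> dominated be hi.
  case/ThE => _ sum_l cross; apply: dominated_tails => [|i]; first by lia.
  by rewrite hiE /= nth_drop add2n; case: (cross i.+1).
have sum_Th be : Th (eta', be) -> sumn eta' + sumn be = l by case/ThE.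
have Th_fst ab : Th ab -> ab = (eta', ab.2) by case: ab => al be /ThE[->].
split=> ab; split=> [[Th_ab ext]|->].
- have ab_eta := Th_fst ab Th_ab.
  move: ab.2 ab_eta Th_ab ext => be -> Th_be ext; apply/esym/ext => //.
  by apply: precedes_of_dominated; [| exact: sum_Th | exact: lo_be].
- split=> // -[al be] Th_ab; have [al_eta] := Th_fst _ Th_ab.
  rewrite al_eta in Th_ab * => le_be; congr pair.
  by apply: precedes_dominated_eq le_be _; exact: lo_be.
- have ab_eta := Th_fst ab Th_ab.
  move: ab.2 ab_eta Th_ab ext => be -> Th_be ext; apply/esym/ext => //.
  by apply: precedes_of_dominated; [| exact: sum_Th | exact: be_hi].
split=> // -[al be] Th_ab; have [al_eta] := Th_fst _ Th_ab.
rewrite al_eta in Th_ab * => le_be; congr pair.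
by apply/esym; apply: precedes_dominated_eq le_be _; exact: be_hi.
Qed.
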